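(* For every $n\ge 2$, $$\mathcal D_{n-2}^{(n)}=(n-1)\,((n-2)!)^2\sum_{1\le i<j\le n}(x_i-x_j)^2.$$ Equivalently, $$\mathcal D_{n-2}^{(n)}=n(n-1)\,((n-2)!)^2\,p_2.$$
   Context: Let $P(t)=\prod_{i=1}^n(t-x_i)$ be a monic polynomial of degree $n$ with roots $x_1,\dots,x_n$, and for $0\le k\le n-2$ let $\mathcal D_k^{(n)}=\operatorname{disc}(P^{(k)})$ with the usual leading-coefficient normalization: $\operatorname{disc}(P^{(k)})=(-1)^{m(m-1)/2}c^{-1}\operatorname{Res}(P^{(k)},P^{(k+1)})$, where $m=n-k$ and $c$ is the leading coefficient of $P^{(k)}$. Put $\bar x=\frac1n\sum_{i=1}^n x_i$, $z_i=x_i-\bar x$, and $p_r=\sum_{i=1}^n z_i^r$. *)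

(* Defs.v *)
From mathcomp Require Import all_boot all_order all_algebra.

Set Implicit Arguments.
Unset Strict Implicit.
Unset Printing Implicit Defensive.

Import GRing.Theory.
Local Open Scope ring_scope.

(* The library's Sylvester matrix lists coefficients by increasing degree, so  *)
(* [resultant p q] is (-1) ^+ (deg p * deg q) times the usual Res(p, q). In    *)
(* characteristic 0, deg p * deg p^`() = m (m - 1) is even, so here the two    *)
(* agree.                                                                      *)
Definition disc (F : fieldType) (p : {poly F}) : F :=
  let m := (size p).-1 in
  (-1) ^+ (m * (m - 1))./2 * (lead_coef p)^-1 * resultant p p^`().

Definition poly_of_roots (F : fieldType) (n : nat) (x : 'I_n -> F) : {poly F} :=
  \prod_(i < n) ('X - (x i)%:P).

Definition derivative_disc (F : fieldType) (n : nat) (x : 'I_n -> F) (k : nat) : F :=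
  disc (poly_of_roots x)^`(k).

Definition mean (F : fieldType) (n : nat) (x : 'I_n -> F) : F :=
  n%:R^-1 * \sum_(i < n) x i.

Definition centered (F : fieldType) (n : nat) (x : 'I_n -> F) (i : 'I_n) : F :=
  x i - mean x.

Definition centered_power_sum (F : fieldType) (n : nat) (x : 'I_n -> F) (r : nat) : F :=
  \sum_(i < n) centered x i ^+ r.

(* Main.v *)
(* The (n-2)-nd derivative of P is the quadratic
   n!/2 t^2 - (n-1)! e_1 t + (n-2)! e_2, whose discriminant b^2 - 4ac is
   (n-1) ((n-2)!)^2 ((n-1) e_1^2 - 2n e_2). Since 2 e_2 = e_1^2 - (sum of the
   x_i^2), the last factor is n (sum of the x_i^2) - e_1^2, and both right-hand
   sides reduce to this expression.                                            *)
Require Import Defs.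
From mathcomp Require Import all_boot all_order all_algebra.
From mathcomp Require Import ring.

Set Implicit Arguments.
Unset Strict Implicit.
Unset Printing Implicit Defensive.

Import GRing.Theory.
Local Open Scope ring_scope.

(** The Sylvester matrix is 3 by 3, with one row of coefficients of [p] and two shifted rows of
    coefficients of [q]; the right-hand side is its expanded determinant. *)
Lemma resultant_quadratic_linear (R : comNzRingType) (p q : {poly R}) :
  size p = 3 -> size q = 2 ->
  resultant p q = p`_0 * q`_1 ^+ 2 - p`_1 * q`_0 * q`_1 + p`_2 * q`_0 ^+ 2.
Proof.
case: p => [[|c [|b [|a []]]]] // np; case: q => [[|d [|e []]]] // nq _ _.
rewrite /resultant.
have SE := @Sylvester_mxE R (Polynomial np) (Polynomial nq).
rewrite /= in SE *.
set M := Sylvester_mx _ _ in SE *.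
have S0 (j : 'I_3) : M ord0 j = [:: c; b; a]`_j.
  rewrite SE; case: splitP => [k /= Ek|k]; last by [].
  by rewrite -Ek subn0 mulr1n.
have S1 (i j : 'I_3) : (0 < i)%N ->
    M i j = [:: d; e]`_(j - i.-1) *+ (i.-1 <= j)%N.
  move=> i0; rewrite SE; case: splitP => [k /= Ek|k /= ->] //.
  by move: i0; rewrite Ek ord1.
(* From here on [M] is known only through its rows [S0] and [S1]. *)
clearbody M; clear SE.
rewrite (expand_det_row _ ord0) !big_ord_recl big_ord0 /cofactor.
rewrite !(expand_det_row _ ord0) !big_ord_recl !big_ord0 /cofactor.
rewrite !det_mx11 !mxE !S0 !S1 //=.
rewrite /bump /=.
by ring.
Qed.

(** For [p] = a t^2 + b t + c the resultant with 2 a t + b is a (4 a c - b^2); dividing by a and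
    applying the sign -1, from m = 2, gives b^2 - 4 a c. The second size hypothesis says that 2 a is
    nonzero. *)
Lemma disc_quadratic (F : fieldType) (p : {poly F}) :
  size p = 3 -> size p^`() = 2 -> disc p = p`_1 ^+ 2 - 4 * p`_0 * p`_2.
Proof.
move=> sp sp'.
rewrite /disc (resultant_quadratic_linear sp sp') lead_coefE sp.
have a0 : p`_2 != 0.
  by have := lead_coef_eq0 p; rewrite lead_coefE -size_poly_eq0 sp => ->.
by rewrite !coef_deriv /=; field.
Qed.

(** The coefficient is e_2, and doubling it avoids division. Splitting off a root y, the induction
    uses e_2(y, s) = e_2(s) + y e_1(s). *)
Lemma coefPPn_prod_XsubC (R : comNzRingType) (s : seq R) (m : nat) :
  size s = m.+2 ->
  2 * (\prod_(x <- s) ('X - x%:P))`_m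
    = (\sum_(x <- s) x) ^+ 2 - \sum_(x <- s) x ^+ 2.
Proof.
elim: m s => [|m IHm] [|y s] //= [sz];
  rewrite !big_cons mulrBl coefB coefXM coefCM.
  case: s sz => [|z []] //= _; rewrite !big_seq1 coefB coefX coefC /=.
  by ring.
rewrite /= mulrBr IHm //.
have := coefPn_prod_XsubC (ps := s); rewrite sz => -> //=.
by ring.
Qed.

(** Twice the sum over i < j is the sum over all pairs, by symmetry and because the diagonal
    vanishes; the full sum then expands termwise. *)
Lemma sum_sqr_sub_lt (R : comNzRingType) (n : nat) (x : 'I_n -> R) :
  2 * \sum_(i < n) \sum_(j < n | (i < j)%N) (x i - x j) ^+ 2
    = 2 * (n%:R * \sum_(i < n) x i ^+ 2 - (\sum_(i < n) x i) ^+ 2).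
Proof.
transitivity (\sum_(i < n) \sum_(j < n) (x i - x j) ^+ 2).
  transitivity (\sum_(i < n) \sum_(j < n)
      ((if (i < j)%N then (x i - x j) ^+ 2 else 0)
       + (if (j < i)%N then (x j - x i) ^+ 2 else 0))).
    under [RHS]eq_bigr do rewrite big_split.
    rewrite big_split [X in _ = _ + X]exchange_big /= mulr2n mulrDl mul1r.
    by congr (_ + _); apply: eq_bigr => i _; rewrite big_mkcond.
  apply: eq_bigr => i _; apply: eq_bigr => j _.
  case: (ltngtP i j) => [_|_|/val_inj->]; first by rewrite addr0.
  - by rewrite add0r -opprB sqrrN.
  - by rewrite subrr expr0n addr0.
have inner i : \sum_(j < n) (x i - x j) ^+ 2
    = n%:R * x i ^+ 2 - 2 * (\sum_(j < n) x j) * x i + \sum_(j < n) x j ^+ 2.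
  have -> : n%:R * x i ^+ 2 = \sum_(j < n) x i ^+ 2.
    by rewrite sumr_const card_ord mulr_natl.
  rewrite mulrAC big_distrr -sumrB -big_split /=.
  by apply: eq_bigr => j _; ring.
under eq_bigr do rewrite inner.
rewrite big_split sumrB -!big_distrr /= sumr_const card_ord -mulr_natl.
by ring.
Qed.

Lemma centered_power_sum2 (F : fieldType) (n : nat) (x : 'I_n -> F) :
  n%:R != 0 :> F ->
  n%:R * centered_power_sum x 2
    = n%:R * \sum_(i < n) x i ^+ 2 - (\sum_(i < n) x i) ^+ 2.
Proof.
move=> n0; rewrite /centered_power_sum /centered.
have inner i : (x i - mean x) ^+ 2 = x i ^+ 2 - 2 * mean x * x i + mean x ^+ 2.
  by ring.
under eq_bigr do rewrite inner.
rewrite big_split sumrB -big_distrr /= sumr_const card_ord -mulr_natl /mean.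
by field.
Qed.

Theorem proposition2 (F : fieldType) (charF0 : [pchar F] =i pred0)
    (n : nat) (n_ge2 : (2 <= n)%N) (x : 'I_n -> F) :
  derivative_disc x (n - 2)
    = (n - 1)%:R * (((n - 2)`!)%:R) ^+ 2
      * \sum_(i < n) \sum_(j < n | (i < j)%N) (x i - x j) ^+ 2
  /\
  derivative_disc x (n - 2)
    = n%:R * (n - 1)%:R * (((n - 2)`!)%:R) ^+ 2 * centered_power_sum x 2.
Proof.
have nat0 k : (k%:R == 0 :> F) = (k == 0%N) by move/pcharf0P: charF0.
have two0 : (2 : F) != 0 by rewrite nat0.
have n0 : n%:R != 0 :> F by rewrite nat0 -lt0n ltnW.
have -> : n%:R * (n - 1)%:R * ((n - 2)`!)%:R ^+ 2 * centered_power_sum x 2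
    = (n - 1)%:R * ((n - 2)`!)%:R ^+ 2 * (n%:R * centered_power_sum x 2) :> F.
  by ring.
rewrite centered_power_sum2 // (mulfI two0 (sum_sqr_sub_lt x)).
suff D : derivative_disc x (n - 2) = (n - 1)%:R * ((n - 2)`!)%:R ^+ 2
    * (n%:R * \sum_(i < n) x i ^+ 2 - (\sum_(i < n) x i) ^+ 2) by split.
case: n n_ge2 x n0 => [|[|m]] // _ x n0.
rewrite !subSS !subn0 /derivative_disc.
(* The roots are listed as a sequence so that the coefficient lemmas for products over sequences
   apply. *)
pose s := [seq x i | i <- enum 'I_m.+2].
have ss : size s = m.+2 by rewrite size_map size_enum_ord.
have PE : poly_of_roots x = \prod_(y <- s) ('X - y%:P).
  by rewrite /poly_of_roots big_map big_enum.
have e1E : \sum_(y <- s) y = \sum_(i < m.+2) x i by rewrite big_map big_enum.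
have p2E : \sum_(y <- s) y ^+ 2 = \sum_(i < m.+2) x i ^+ 2.
  by rewrite big_map big_enum.
set P := poly_of_roots x in PE *.
have sP : size P = m.+3 by rewrite PE size_prod_XsubC ss.
have P2 : P`_(m + 2) = 1.
  rewrite addn2; have /monicP := monic_prod_XsubC s xpredT id.
  by rewrite lead_coefE -PE sP.
have P1 : P`_(m + 1) = - \sum_(i < m.+2) x i.
  by rewrite addn1 -e1E PE -coefPn_prod_XsubC ss.
have P0 := coefPPn_prod_XsubC ss; rewrite -PE e1E p2E in P0.
have fact_nz k : (k`!)%:R != 0 :> F by rewrite nat0 -lt0n fact_gt0.
have c0 : P^`(m)`_0 = (m`!)%:R * P`_m.
  by rewrite coef_derivn addn0 ffactnn mulr_natl.
have c1 : P^`(m)`_1 = - ((m.+1)`!)%:R * \sum_(i < m.+2) x i.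
  rewrite coef_derivn P1 mulNrn -[in LHS]mulr_natl mulNr; congr (- (_%:R * _)).
  by rewrite -[m.+1]addn1 -(@ffact_fact (m + 1) m) ?leq_addr // addKn muln1.
(* The leading coefficient is (m+2)!/2!, again stated doubled. *)
have c2 : 2 * P^`(m)`_2 = ((m.+2)`!)%:R.
  rewrite coef_derivn P2 -natrM mulnC; congr (_%:R).
  by rewrite -[m.+2]addn2 -(@ffact_fact (m + 2) m) ?leq_addr // addKn.
have Q3 : size P^`(m) = 3.
  apply/eqP; rewrite eqn_leq; apply/andP; split.
    apply/leq_sizeP => j j3; rewrite coef_derivn nth_default ?mul0rn //.
    by rewrite sP -addn3 leq_add2l.
  (* A smaller size would make the coefficient of t^2 vanish, hence (m+2)! = 0 by [c2], impossible
     in characteristic 0. *)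
  rewrite ltnNge; apply/negP => /leq_sizeP/(_ 2 isT) Q2.
  by move: (fact_nz m.+2); rewrite -c2 Q2 mulr0 eqxx.
have Q2 : size P^`(m)^`() = 2.
  apply/eqP; rewrite eqn_leq; apply/andP; split.
    by have := @lt_size_deriv _ P^`(m); rewrite -size_poly_eq0 Q3; apply.
  rewrite ltnNge; apply/negP => /leq_sizeP/(_ 1 isT).
  by rewrite coef_deriv -mulr_natl c2 => /eqP; rewrite (negPf (fact_nz _)).
rewrite disc_quadratic // c1 c0.
(* The extra factor 2 splits 8 as 2 * 2 * 2, which exposes the doubled coefficients evaluated by
   [P0] and [c2]. *)
apply: (mulfI two0).
have -> : 2 * ((- (m.+1)`!%:R * \sum_(i < m.+2) x i) ^+ 2
      - 4 * ((m`!)%:R * P`_m) * P^`(m)`_2)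
    = 2 * ((m.+1)`!%:R * \sum_(i < m.+2) x i) ^+ 2
      - 2 * (m`!)%:R * (2 * P`_m) * (2 * P^`(m)`_2) by ring.
rewrite P0 c2 !factS !natrM.
by ring.
Qed.
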